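(* The escape rate game has a uniform value, which coincides with $\rho:=\lim_{k\to\infty}\frac{[S^kd(\cdot,x_0)](x_0)}{k}$. Furthermore: (i) given any $v\in\mathrm{Lip}_1$ with $\rho+v\leq Sv$, player Max possesses a stationary optimal strategy, obtained by choosing at turn $k+1$ an action maximizing $b\mapsto v(T_{a_{k+1}b}(x_k))$ over $\mathcal{B}$; (ii) player Min possesses a (history dependent) optimal strategy, and for all $\epsilon>0$, player Min admits an $\epsilon$-optimal strategy that is $q$-cyclic for some $q\geq 1$.
   Context: A hemi-metric on a nonempty set $X$ is a map $d:X\times X\to\mathbb{R}$ (possibly negative, not necessarily symmetric) such that $d(x,z)\leq d(x,y)+d(y,z)$ for all $x,y,z$, and $d(x,y)=d(y,x)=0$ if and only if $x=y$. The space $X$ carries the topology of the metric $d^\circ(x,y)=\max(d(x,y),d(y,x))$. A self-map $T$ of $X$ is nonexpansive if $d(T(x),T(y))\leq d(x,y)$ for all $x,y$. Setting: $(X,d)$ is a hemi-metric space, $\mathcal{A},\mathcal{B}$ are nonempty compact sets (action spaces), and for each $(a,b)\in\mathcal{A}\times\mathcal{B}$, $T_{ab}:X\to X$ is nonexpansive. Standing assumption: for all $x\in X$ the maps $b\mapsto T_{ab}(x)$ (each $a$) and $a\mapsto T_{ab}(x)$ (each $b$) are continuous, and for every compact $K\subset X$ the set $\{T_{ab}(x)\mid (a,b,x)\in\mathcal{A}\times\mathcal{B}\times K\}$ is compact. $\mathrm{Lip}_1$ is the set of functions $v:X\to\mathbb{R}$ with $v(x)-v(y)\leq d(x,y)$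 for all $x,y\in X$. The Shapley operator $S:\mathrm{Lip}_1\to\mathrm{Lip}_1$ is $Sv(x)=\inf_{a\in\mathcal{A}}\sup_{b\in\mathcal{B}}v(T_{ab}(x))$. Escape rate game: from an initial state $x_0\in X$, at each turn $k\geq1$ player Min chooses $a_k\in\mathcal{A}$, then player Max, having observed $a_k$, chooses $b_k\in\mathcal{B}$, and $x_k=T_{a_kb_k}(x_{k-1})$. A strategy $\sigma$ of Min maps each finite history $(x_0,a_1,b_1,x_1,\dots,a_k,b_k,x_k)$ to an element of $\mathcal{A}$; a strategy $\tau$ of Max maps each such history together with Min's next action to an element of $\mathcal{B}$. A strategy of Max is stationary if it depends only on the current state and the last action of Min. Let $J_k(\sigma,\tau)=d(x_k,x_0)$ for the play generated by $(\sigma,\tau)$; the game $\Gamma_k$ in horizon $k$ has payoff $J_k$. In the escape rate game, Min minimizes and Max maximizes $J_\infty(\sigma,\tau)=\limsup_{k\to\infty}J_k(\sigma,\tau)/k$. If $\rho$ is the value, a strategy $\sigma^*$ of Min is $\epsilon$-optimal if $J_\infty(\sigma^*,\tau)\leq\rho+\epsilon$ for all $\tau$, a strategy $\tau^*$ of Max is $\epsilon$-optimal if $J_\infty(\sigma,\tau^* )\geq\rho-\epsilon$ for all $\sigma$; optimal means $\epsilon$-optimal with $\epsilon=0$. The game has uniform value $v_\infty\in\mathbb{R}$ if for all $\epsilon>0$ there exist strategies $\sigma_\epsilon,\tau_\epsilon$ (of Min and Max) and $N$ such that for all $k\geq N$ and all strategies $\sigma$ of Min and $\tau$ of Max, $J_k(\sigma_\epsilon,\tau)/k\leq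 v_\infty+\epsilon$ and $J_k(\sigma,\tau_\epsilon)/k\geq v_\infty-\epsilon$. A strategy of Min is $q$-cyclic if Min chooses a strategy for $\Gamma_q$ and repeats it indefinitely: for $m\geq0$ and $1\leq\ell\leq q$, the action at turn $mq+\ell$ is obtained by applying the fixed strategy for $\Gamma_q$ to the history $(x_0,a_{mq+1},b_{mq+1},T_{a_{mq+1}b_{mq+1}}(x_0),\dots,a_{mq+\ell-1},b_{mq+\ell-1},T_{a_{mq+\ell-1}b_{mq+\ell-1}}\circ\cdots\circ T_{a_{mq+1}b_{mq+1}}(x_0))$, i.e. Min forgets the first $mq$ turns and plays $\Gamma_q$ as if restarting from $x_0$. *)

(* Defs.v *)
(* MathComp / MathComp-Analysis *)
From mathcomp Require Import all_boot all_order all_algebra.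
From mathcomp Require Import all_classical all_reals all_analysis.

Set Implicit Arguments.
Unset Strict Implicit.
Unset Printing Implicit Defensive.

Import Order.TTheory GRing.Theory Num.Theory.

Local Open Scope classical_set_scope.
Local Open Scope ring_scope.

Definition hemi_metric (R : realType) (X : Type) (d : X -> X -> R) : Prop :=
  (forall x y z, d x z <= d x y + d y z) /\
  (forall x y, (d x y = 0 /\ d y x = 0) <-> x = y).

Definition nonexpansive (R : realType) (X : Type) (d : X -> X -> R)
    (f : X -> X) : Prop :=
  forall x y, d (f x) (f y) <= d x y.

Definition Lip1 (R : realType) (X : Type) (d : X -> X -> R) : set (X -> R) :=
  [set v | forall x y, v x - v y <= d x y].

(* Real-valued [inf] and [sup]: the ranges are nonempty and bounded when [v] is
   in [Lip1 d], [A] and [B] are nonempty, and every orbit set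
   [{T a b x | a, b}] is compact. *)
Definition shapley (R : realType) (A B X : Type) (T : A -> B -> X -> X)
    (v : X -> R) : X -> R :=
  fun x => inf (range (fun a : A => sup (range (fun b : B => v (T a b x))))).

(* [(x0, [:: (a_1, b_1, x_1); ...; (a_k, b_k, x_k)])] is the history
   (x_0, a_1, b_1, x_1, ..., a_k, b_k, x_k). *)
Definition history (A B X : Type) : Type := (X * seq (A * B * X))%type.

Definition state (A B X : Type) (h : history A B X) : X :=
  last h.1 [seq t.2 | t <- h.2].

Definition min_strategy (A B X : Type) : Type := history A B X -> A.

Definition max_strategy (A B X : Type) : Type := history A B X -> A -> B.

Definition step (A B X : Type) (T : A -> B -> X -> X)
    (sigma : min_strategy A B X) (tau : max_strategy A B X)
    (h : history A B X) : history A B X :=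
  let a := sigma h in
  let b := tau h a in
  (h.1, rcons h.2 (a, b, T a b (state h))).

Definition play (A B X : Type) (T : A -> B -> X -> X) (x0 : X)
    (sigma : min_strategy A B X) (tau : max_strategy A B X) (k : nat) :
    history A B X :=
  iter k (step T sigma tau) (x0, [::]).

Definition payoff (R : realType) (A B X : Type) (d : X -> X -> R)
    (T : A -> B -> X -> X) (x0 : X)
    (sigma : min_strategy A B X) (tau : max_strategy A B X) (k : nat) : R :=
  d (state (play T x0 sigma tau k)) x0.

Definition escape_payoff (R : realType) (A B X : Type) (d : X -> X -> R)
    (T : A -> B -> X -> X) (x0 : X)
    (sigma : min_strategy A B X) (tau : max_strategy A B X) : \bar R :=
  limn_esup (fun k : nat => (payoff d T x0 sigma tau k / k%:R)%:E).

Definition eps_optimal_min (R : realType) (A B X : Type) (d : X -> X -> R)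
    (T : A -> B -> X -> X) (x0 : X) (rho eps : R)
    (sigma : min_strategy A B X) : Prop :=
  forall tau : max_strategy A B X,
    (escape_payoff d T x0 sigma tau <= (rho + eps)%:E)%E.

Definition eps_optimal_max (R : realType) (A B X : Type) (d : X -> X -> R)
    (T : A -> B -> X -> X) (x0 : X) (rho eps : R)
    (tau : max_strategy A B X) : Prop :=
  forall sigma : min_strategy A B X,
    ((rho - eps)%:E <= escape_payoff d T x0 sigma tau)%E.

Definition optimal_min (R : realType) (A B X : Type) (d : X -> X -> R)
    (T : A -> B -> X -> X) (x0 : X) (rho : R)
    (sigma : min_strategy A B X) : Prop :=
  eps_optimal_min d T x0 rho 0 sigma.

Definition optimal_max (R : realType) (A B X : Type) (d : X -> X -> R)
    (T : A -> B -> X -> X) (x0 : X) (rho : R)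
    (tau : max_strategy A B X) : Prop :=
  eps_optimal_max d T x0 rho 0 tau.

Definition uniform_value (R : realType) (A B X : Type) (d : X -> X -> R)
    (T : A -> B -> X -> X) (x0 : X) (vinf : R) : Prop :=
  forall eps : R, 0 < eps ->
    exists (sigma_eps : min_strategy A B X) (tau_eps : max_strategy A B X)
           (N : nat),
      forall k : nat, (N <= k)%N ->
      forall (sigma : min_strategy A B X) (tau : max_strategy A B X),
        payoff d T x0 sigma_eps tau k / k%:R <= vinf + eps /\
        vinf - eps <= payoff d T x0 sigma tau_eps k / k%:R.

Definition stationary (A B X : Type) (tau : max_strategy A B X) : Prop :=
  exists g : X -> A -> B, forall h a, tau h a = g (state h) a.

Definition greedy (R : realType) (A B X : Type) (T : A -> B -> X -> X)
    (v : X -> R) (tau : max_strategy A B X) : Prop :=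
  forall (h : history A B X) (a : A) (b : B),
    v (T a b (state h)) <= v (T a (tau h a) (state h)).

(* The turns obtained by playing the actions recorded in [s] from [x],
   discarding the states recorded in [s]. *)
Fixpoint replay (A B X : Type) (T : A -> B -> X -> X) (x : X)
    (s : seq (A * B * X)) : seq (A * B * X) :=
  if s is (a, b, _) :: s' then (a, b, T a b x) :: replay T (T a b x) s'
  else [::].

(* [size h.2] turns have been played; the first [m * q] of them, with
   [m = size h.2 %/ q], are forgotten. *)
Definition restart (A B X : Type) (T : A -> B -> X -> X) (q : nat)
    (h : history A B X) : history A B X :=
  (h.1, replay T h.1 (drop (size h.2 %/ q * q) h.2)).

(* Only the values of [s] on histories of fewer than [q] turns are used, so
   [s] stands for a strategy in the game with horizon [q]. *)
Definition cyclic_strategy (A B X : Type) (T : A -> B -> X -> X) (q : nat)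
    (sigma : min_strategy A B X) : Prop :=
  exists s : min_strategy A B X, forall h, sigma h = s (restart T q h).

(* Main.v *)
Require Import Defs.
From mathcomp Require Import all_boot all_order all_algebra.
From mathcomp Require Import all_classical all_reals all_analysis.
From mathcomp Require Import lra ring zify.

Import Order.TTheory GRing.Theory Num.Theory.
Import numFieldNormedType.Exports.

Local Open Scope classical_set_scope.
Local Open Scope ring_scope.

(* Let [S] be the Shapley operator, [s_k = (S^k d(., x0))(x0)].  As [s] is
   subadditive, [s_k / k] converges to [rho = inf_k s_k / k].

   Max: the game in which Min may stop at any turn [j] and pay
   [d(x_j, x0) - rho j] has value 0 at [x0] in every horizon, since a strictly
   negative value could be repeated, by nonexpansiveness, to force a rate below
   [rho].  Its values decrease to some [v] in [Lip1] with [rho + v <= S v], and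
   playing greedily for [v] yields [d(x_k, x0) >= v(x_k) - v(x0) >= rho k].

   Min: play near-optimally in the [q]-stage game on a simulated state restarted
   from [x0] at each block.  By nonexpansiveness each block increases
   [d(x_k, x0)] by at most [s_q + 1].  Blocks of constant length give the cyclic
   strategies, blocks of increasing length the optimal one. *)

(** * Inf-sup values of bounded functions of two actions *)

Section InfSup.
Context {R : realType} {A B : Type} (hA0 : [set: A] !=set0) (hB0 : [set: B] !=set0).
Implicit Types (f g : A -> B -> R) (M c : R).

Definition inf_sup f : R := inf (range (fun a => sup (range (f a)))).

Lemma sup_range_le (h : B -> R) c : (forall b, h b <= c) -> sup (range h) <= c.
Proof.
by move=> hc; apply: ge_sup => [|_ [b _ <-]]; [exact: image_nonempty|exact: hc].
Qed.

Lemma le_sup_range (h : B -> R) M b : (forall b, h b <= M) -> h b <= sup (range h).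
Proof.
by move=> hM; apply: ub_le_sup; [exists M => _ [b' _ <-]; exact: hM|exists b].
Qed.

Lemma inf_sup_ge f M c : (forall a b, f a b <= M) ->
  (forall a, exists b, c <= f a b) -> c <= inf_sup f.
Proof.
move=> fM cf; apply: lb_le_inf => [|_ [a _ <-]]; first exact: image_nonempty.
by have [b cb] := cf a; apply: le_trans cb _; apply: le_sup_range (fM a).
Qed.

(** The two-sided bound gives the suprema the lower bound [- M], so that [inf] is a genuine infimum
    and not a default value. *)
Lemma inf_sup_le f M a c : (forall a b, `|f a b| <= M) ->
  (forall b, f a b <= c) -> inf_sup f <= c.
Proof.
move=> fM fc; apply: le_trans (sup_range_le _ _ fc).
apply: ge_inf; last by exists a.
have [b _] := hB0; exists (- M) => _ [a' _ <-].
apply: (@le_trans _ _ (f a' b)); first by have /ler_normlP[] := fM a' b; lra.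
by apply: (@le_sup_range _ M) => b'; apply: le_trans (ler_norm _) (fM _ _).
Qed.

Lemma inf_sup_adherent f M e : 0 < e -> (forall a b, `|f a b| <= M) ->
  exists a, forall b, f a b <= inf_sup f + e.
Proof.
move=> e0 fM.
have fM' a b : f a b <= M by apply: le_trans (ler_norm _) (fM _ _).
have infR : has_inf (range (fun a => sup (range (f a)))).
  split; first exact: image_nonempty.
  have [b _] := hB0; exists (- M) => _ [a _ <-].
  apply: (@le_trans _ _ (f a b)); first by have /ler_normlP[] := fM a b; lra.
  exact: le_sup_range.
have [_ [a _ <-] /ltW lta] := inf_adherent e0 infR.
by exists a => b; apply: le_trans lta; apply: le_sup_range (fM' a).
Qed.

Lemma inf_sup_leD f g M N c : (forall a b, `|f a b| <= M) ->
  (forall a b, `|g a b| <= N) -> (forall a b, f a b <= g a b + c) ->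
  inf_sup f <= inf_sup g + c.
Proof.
move=> fM gN fg; apply/ler_addgt0Pl => e e0.
have [a ga] := inf_sup_adherent _ _ _ e0 gN.
apply: (inf_sup_le _ _ a _ fM) => b.
by apply: le_trans (fg a b) _; have := ga b; lra.
Qed.

End InfSup.

(** * Hemi-metrics and the 1-Lipschitz functions they define *)

Section HemiMetric.
Context {R : realType} {X : Type} {d : X -> X -> R}.
Hypothesis hd : hemi_metric d.

Lemma hemi_metric_triangle y x z : d x z <= d x y + d y z.
Proof. by case: hd. Qed.

Lemma hemi_metric_xx x : d x x = 0.
Proof. by have [_ /(_ x x)[_ /(_ erefl)[]]] := hd. Qed.

Lemma Lip1_to y : Lip1 d (d ^~ y).
Proof. by move=> x z /=; rewrite lerBlDr hemi_metric_triangle. Qed.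

Lemma Lip1_from y : Lip1 d (fun x => - d y x).
Proof. by move=> x z /=; have := hemi_metric_triangle x y z; lra. Qed.

End HemiMetric.

(** * Functions of [Lip1] on compact sets *)

Section Lip1.
Context {R : realType} {X : metricType R} {d : X -> X -> R}.
Hypothesis hX : forall x y : X, mdist x y = Num.max (d x y) (d y x).

(** The Lipschitz inequality in both orders bounds [|v x - v y|] by the symmetrized metric. *)
Lemma Lip1_continuous (v : X -> R) : Lip1 d v -> continuous v.
Proof.
move=> vL x; apply/cvgrPdist_lt => e e0.
apply/nbhs_ballP; exists e => //= y; rewrite ballEmdist /= hX gt_max => /andP[xy yx].
by rewrite ltr_norml; have := vL x y; have := vL y x; lra.
Qed.

Lemma Lip1_bounded (v : X -> R) (K : set X) : Lip1 d v -> compact K ->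
  exists M, forall x, K x -> `|v x| <= M.
Proof.
move=> vL cK; have : compact (v @` K).
  apply: continuous_compact => //; apply: continuous_subspaceT.
  exact: Lip1_continuous.
move=> /compact_bounded[M [_ MvK]]; exists (M + 1) => x Kx.
by apply: (MvK (M + 1)); [rewrite ltrDl|exists x].
Qed.

(* Dini's theorem *)
Lemma Lip1_nonincreasing_uniform (K : set X) (w : nat -> X -> R) (v : X -> R) :
  compact K -> (forall n, Lip1 d (w n)) -> Lip1 d v ->
  (forall x, nonincreasing_seq (w ^~ x)) ->
  (forall x e, 0 < e -> exists n, w n x < v x + e) ->
  forall e, 0 < e -> exists n, forall x, K x -> w n x <= v x + e.
Proof.
move=> /compact_near_coveringP cK wL vL wdec wv e e0.
have [x Kx|n _ wn] := cK nat \oo (fun n x => w n x <= v x + e) _; last first.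
  by exists n => x; apply: wn => /=.
have [n wn] := wv x e e0.
(* The strict inequality at index [n] persists near [x] by continuity, and for later indices by
   monotonicity. *)
exists ([set y | w n y - v y < e], [set m | (n <= m)%N]) => /=.
  split; last exact: nbhs_infty_ge.
  apply: open_nbhs_nbhs; split => /=; last by lra.
  rewrite (_ : [set x | _] = (w n - v) @^-1` [set y | y < e]) //.
  apply: open_comp => [z _|]; last exact: open_lt.
  by apply: continuousB; exact: Lip1_continuous.
by move=> [y m] /= [yn nm]; have := wdec y n m nm; lra.
Qed.

End Lip1.

(** * The Shapley operator on [Lip1] and its iterates *)

Section Shapley.
Context {R : realType} {X : metricType R} {d : X -> X -> R}.
Hypothesis hd : hemi_metric d.
Hypothesis hX : forall x y : X, mdist x y = Num.max (d x y) (d y x).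
Context {A B : Type} (hA0 : [set: A] !=set0) (hB0 : [set: B] !=set0).
Variable T : A -> B -> X -> X.
Hypothesis hT : forall a b, nonexpansive d (T a b).
Hypothesis hTK : forall x, compact [set y | exists a b, y = T a b x].
Implicit Types (u v : X -> R).

Local Notation S := (shapley T).

Lemma Lip1_orbit_bounded u x : Lip1 d u ->
  exists M, forall a b, `|u (T a b x)| <= M.
Proof.
move=> uL; have [M uM] := Lip1_bounded hX _ _ uL (hTK x).
by exists M => a b; apply: uM; exists a, b.
Qed.

Lemma shapley_leD u v x c : Lip1 d u -> Lip1 d v ->
  (forall a b, u (T a b x) <= v (T a b x) + c) -> S u x <= S v x + c.
Proof.
move=> uL vL; have [M uM] := Lip1_orbit_bounded u x uL.
have [N vN] := Lip1_orbit_bounded v x vL.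
exact: inf_sup_leD hA0 hB0 _ _ _ _ _ uM vN.
Qed.

Lemma shapley_ge u x c : Lip1 d u ->
  (forall a, exists b, c <= u (T a b x)) -> c <= S u x.
Proof.
move=> uL; have [M uM] := Lip1_orbit_bounded u x uL.
apply: (inf_sup_ge hA0 _ M) => a b.
exact: le_trans (ler_norm _) (uM a b).
Qed.

Lemma shapley_le u x a c : Lip1 d u ->
  (forall b, u (T a b x) <= c) -> S u x <= c.
Proof.
move=> uL; have [M uM] := Lip1_orbit_bounded u x uL.
exact: inf_sup_le hB0 _ _ _ _ uM.
Qed.

Lemma shapley_adherent u x e : Lip1 d u -> 0 < e ->
  exists a, forall b, u (T a b x) <= S u x + e.
Proof.
move=> uL e0; have [M uM] := Lip1_orbit_bounded u x uL.
exact: inf_sup_adherent hA0 hB0 _ _ _ e0 uM.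
Qed.

Lemma shapley_Lip1 u : Lip1 d u -> Lip1 d (S u).
Proof.
move=> uL x y /=; rewrite lerBlDl.
have [M uM] := Lip1_orbit_bounded u x uL.
have [N uN] := Lip1_orbit_bounded u y uL.
apply: inf_sup_leD hA0 hB0 _ _ _ _ _ uM uN _ => a b.
by have := uL (T a b x) (T a b y); have := hT a b x y; lra.
Qed.

Variable x0 : X.
Local Notation u_ := (fun k => iter k S (fun x => d x x0)).
Local Notation s_ := (fun k => u_ k x0).

Lemma iter_shapley_Lip1 k : Lip1 d (u_ k).
Proof. by elim: k => [|k IH] /=; [exact: Lip1_to|exact: shapley_Lip1]. Qed.

Lemma iter_shapley_le k x : u_ k x <= s_ k + d x x0.
Proof. by have := iter_shapley_Lip1 k x x0; lra. Qed.

(** In the pointwise form [u_ (m + n) <= u_ m + s_ n], the case [m = 0] is the Lipschitz property of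
    [u_ n], and [S] preserves inequalities up to a constant. *)
Lemma iter_shapley_subadditive m n : s_ (m + n)%N <= s_ m + s_ n.
Proof.
suff H x : u_ (m + n)%N x <= u_ m x + s_ n by [].
elim: m x => [|m IH] x /=; first by rewrite addrC iter_shapley_le.
by apply: shapley_leD => [||a b]; [exact: iter_shapley_Lip1..|exact: IH].
Qed.

(** By nonexpansiveness each turn increases [d x0 x] by at most [C], a bound for [d x0 (T a b x0)];
    moreover [- d x0 x <= d x x0]. *)
Lemma iter_shapley_bounded_below : exists C, forall k, - C * k%:R <= s_ k.
Proof.
have [C hC] := Lip1_orbit_bounded _ x0 (Lip1_from hd x0).
exists C => k.
suff H x : - d x0 x - C * k%:R <= u_ k x.
  by have := H x0; rewrite (hemi_metric_xx hd); lra.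
elim: k x => [|k IH] x /=.
  have := hemi_metric_triangle hd x x0 x0; have := hemi_metric_xx hd x0.
  by have := hemi_metric_triangle hd x0 x x0; lra.
have [b _] := hB0.
apply: shapley_ge => [|a]; first exact: iter_shapley_Lip1.
exists b; apply: le_trans (IH _); rewrite -natr1.
have := hC a b; rewrite normrN => /(le_trans (ler_norm _)).
have := hemi_metric_triangle hd (T a b x0) x0 (T a b x).
by have := hT a b x0 x; lra.
Qed.

(** * A solution of [rho + v <= S v] from the stopping game *)

Section Subsolution.
Variable rho : R.
Hypothesis rho_le : forall k, rho * k%:R <= s_ k.

(* Value of the [n]-stage game in which Min may stop at any turn [j], paying
   [d x_j x0 - rho * j]. *)
Local Notation w_ :=
  (fun n => iter n (fun v x => Num.min (v x) (S v x - rho)) (fun x => d x x0)).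

Lemma stopping_Lip1 n : Lip1 d (w_ n).
Proof.
elim: n => [|n IH] /=; first exact: Lip1_to.
move=> x y /=; have := IH x y; have := shapley_Lip1 _ IH x y.
set a := iter _ _ _ x; set b := iter _ _ _ y.
set a' := shapley _ _ x; set b' := shapley _ _ y => h1 h2.
by rewrite /Num.min; case: ltP => ?; case: ltP => ?; lra.
Qed.

Lemma stopping_nonincreasing x : nonincreasing_seq (fun n => w_ n x).
Proof. by apply/nonincreasing_seqP => n /=; rewrite ge_min lexx. Qed.

(* If a window of [n + 1] consecutive excesses [s_t - rho t] is below [C], then
   the next one is below [C - delta], where [delta > 0] is what Min gains over
   [rho] by stopping; iterating contradicts [rho_le]. *)
Lemma stopping_ge0 n : 0 <= w_ n x0.
Proof.
elim: n => [|n IH] /=; first by rewrite (hemi_metric_xx hd).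
rewrite le_min IH /= leNgt; apply/negP; set v := iter n _ _ => Sv.
pose e t : R := s_ t - rho * t%:R.
pose delta := rho - S v x0.
have delta0 : 0 < delta by rewrite /delta; lra.
(* In horizon [r + j] Min plays the stopping game; when it stops after [i] turns, [r + j - i] turns
   remain and cost at most [s_ (r + j - i) + d x_i x0], which the bound on the excesses controls. *)
have window C j r : (forall i, (i <= j)%N -> e (r + i)%N <= C) ->
    forall x, u_ (r + j)%N x <= rho * (r + j)%:R + C + w_ j x.
  elim: j r => [|j IHj] r rC x.
    by have := rC 0%N isT; have := iter_shapley_le (r + 0) x; rewrite /e /=; lra.
  have rj := IHj r (fun i ij => rC i (leqW ij)).
  have := IHj r.+1; rewrite addSnnS => /(_ _ x) -/(_ _) rSj.
  rewrite /= -lerBlDl le_min; apply/andP; split.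
    rewrite lerBlDl; apply: rSj => i ij; rewrite addSnnS; exact: rC.
  rewrite addnS /= lerBlDl -natr1.
  suff : S (u_ (r + j)%N) x <= S (w_ j) x + (rho * (r + j)%:R + C) by lra.
  apply: shapley_leD; [exact: iter_shapley_Lip1|exact: stopping_Lip1|] => a b.
  by have := rj (T a b x); lra.
(* One turn from [x0] followed by the strategy of [window]: as [S v x0 = rho - delta], the excess
   falls by [delta]. *)
have next C r : (forall i, (i <= n)%N -> e (r + i)%N <= C) ->
    e (r + n.+1)%N <= C - delta.
  move=> /window rn; rewrite /e addnS /= -natr1 /delta.
  suff : S (u_ (r + n)%N) x0 <= S v x0 + (rho * (r + n)%:R + C) by lra.
  apply: shapley_leD; [exact: iter_shapley_Lip1|exact: stopping_Lip1|] => a b.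
  by have := rn (T a b x0); rewrite /v /=; lra.
(* [C] bounds the first [n.+1] excesses, hence all of them by [next]. *)
pose C := \sum_(i < n.+1) `|e i|.
have eC t : e t <= C.
  elim/ltn_ind: t => t IHt; have [nt|tn] := leqP n.+1 t.
    rewrite -(subnK nt); apply: (@le_trans _ _ (C - delta)); last by lra.
    by apply: next => i ni; apply: IHt; lia.
  apply: le_trans (ler_norm _) _.
  by rewrite /C (bigD1 (Ordinal tn)) //= lerDl sumr_ge0.
have em m t : (m * n.+1 <= t)%N -> e t <= C - delta * m%:R.
  elim: m t => [|m IHm] t mt; first by have := eC t; lra.
  rewrite -(@subnK n.+1 t); last by lia.
  rewrite -natr1 (_ : C - _ = C - delta * m%:R - delta); last by ring.
  by apply: next => i ni; apply: IHm; lia.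
(* This multiple of [delta] exceeds [C], so the excess is negative, against [rho_le]. *)
have := em (Num.truncn (C / delta)).+1 _ (leqnn _).
have := rho_le ((Num.truncn (C / delta)).+1 * n.+1).
have := truncnS_gt (C / delta); rewrite ltr_pdivrMr // /e; lra.
Qed.

(** Since [w_ n x0 >= 0], the Lipschitz property bounds [w_ n x] below by [- d x0 x], so the infimum
    [v] is finite. Dini's theorem on the compact orbit of [x] lets [n] tend to infinity in
    [w_ n.+1 x <= S (w_ n) x - rho]. *)
Lemma exists_subsolution :
  exists v, Lip1 d v /\ forall x, rho + v x <= S v x.
Proof.
have wlb x n : - d x0 x <= w_ n x.
  by have := stopping_Lip1 n x0 x; have := stopping_ge0 n; lra.
have lb x : has_lbound (range (fun n => w_ n x)).
  by exists (- d x0 x) => _ [n _ <-].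
pose v x := inf (range (fun n => w_ n x)).
have vw x n : v x <= w_ n x by apply: ge_inf => //; exists n.
have wv x e : 0 < e -> exists n, w_ n x < v x + e.
  move=> e0; have [|_ [n _ <-] ?] := @inf_adherent _ (range (fun n => w_ n x)) _ e0.
    by split=> //; exists (w_ 0%N x), 0%N.
  by exists n.
have vL : Lip1 d v.
  move=> x y /=; apply/ler_addgt0Pl => e e0.
  have [n wn] := wv y e e0.
  by have := stopping_Lip1 n x y; have := vw x n; lra.
exists v; split=> // x; apply/ler_addgt0Pl => e e0.
have [n wn] := Lip1_nonincreasing_uniform hX _ w_ v (hTK x) stopping_Lip1 vL
  stopping_nonincreasing wv e e0.
have := vw x n.+1; rewrite /= le_min => /andP[_].
suff : S (w_ n) x <= S v x + e by lra.
apply: shapley_leD => // [|a b]; first exact: stopping_Lip1.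
by apply: wn; exists a, b.
Qed.

End Subsolution.
End Shapley.

(** * Linear growth rates of real sequences *)

Section Rates.
Context {R : realType}.
Implicit Types (s a : nat -> R) (c r C D e : R).

Lemma ler_normM_nat c m n : (m <= n)%N -> c * m%:R <= `|c| * n%:R.
Proof.
move=> mn; apply: (@le_trans _ _ (`|c| * m%:R)).
  by rewrite ler_wpM2r // ler_norm.
by rewrite ler_wpM2l // ler_nat.
Qed.

(* Fekete's lemma *)
Lemma subadditive_rate s C : (forall m n, s (m + n)%N <= s m + s n) ->
  (forall k, - C * k%:R <= s k) ->
  exists rho, (forall k, rho * k%:R <= s k) /\
    forall e, 0 < e -> exists D, forall k, s k <= (rho + e) * k%:R + D.
Proof.
move=> sD sC; pose E := [set s k.+1 / k.+1%:R | k in [set: nat]].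
have E0 : has_inf E.
  split; first by exists (s 1%N / 1%:R), 0%N.
  by exists (- C) => _ [k _ <-]; rewrite ler_pdivlMr.
exists (inf E); split=> [[|k]|e e0].
- by have := sC 0%N; rewrite !mulr0.
- rewrite -ler_pdivlMr //; apply: ge_inf; [by case: E0|by exists k].
have [_ [q _ <-]] := inf_adherent e0 E0; rewrite ltr_pdivrMr // => sq.
pose r := inf E + e; pose M := \sum_(i < q.+1) `|s i|.
(* [M] bounds [s] at the remainder of [k] modulo [q.+1]; the other term pays for rounding [k] down
   to a multiple of [q.+1], whatever the sign of [r]. *)
exists (M + `|r| * q.+1%:R) => k.
have smod : s (k %% q.+1)%N <= M.
  apply: le_trans (ler_norm _) _.
  by rewrite /M (bigD1 (Ordinal (ltn_pmod k (ltn0Sn q)))) //= lerDl sumr_ge0.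
have sdiv m n : s (m * q.+1 + n)%N <= r * (m * q.+1)%:R + s n.
  elim: m => [|m IHm]; first by rewrite mul0n mulr0 add0r.
  rewrite mulSn -addnA; apply: le_trans (sD _ _) _.
  by rewrite natrD mulrDr; move: IHm sq; rewrite -/r; lra.
have := sdiv (k %/ q.+1)%N (k %% q.+1)%N; rewrite -divn_eq => sk.
have kE : k%:R = (k %/ q.+1 * q.+1)%:R + (k %% q.+1)%:R :> R.
  by rewrite -natrD -divn_eq.
have : - (r * (k %% q.+1)%:R) <= `|r| * q.+1%:R.
  apply: le_trans (ler_norm _) _; rewrite normrN normrM.
  by rewrite ler_wpM2l // ger0_norm // ler_nat ltnW // ltn_pmod.
by rewrite -/r kE mulrDr; lra.
Qed.

(** [N] is chosen before [x], so one threshold serves all strategies of the opponent. *)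
Lemma affine_div_le r D e : 0 < e ->
  exists N, forall k x, (N <= k)%N -> x <= r * k%:R + D -> x / k%:R <= r + e.
Proof.
move=> e0; exists (Num.truncn (D / e)).+1 => k x Nk xD.
have k0 : 0 < k%:R :> R by rewrite ltr0n; lia.
have := truncnS_gt (D / e); rewrite ltr_pdivrMr // => De.
rewrite ler_pdivrMr // mulrDl; apply: le_trans xD _; rewrite lerD2l.
by apply: le_trans (ltW De) _; rewrite mulrC ler_wpM2l ?ler_nat // ltW.
Qed.

Lemma cvg_rate a r : (forall k, r * k%:R <= a k) ->
  (forall e, 0 < e -> exists D, forall k, a k <= (r + e) * k%:R + D) ->
  (fun k => a k / k%:R) @ \oo --> r.
Proof.
move=> ra aD; apply/cvgrPdist_le => e e0.
have e20 : 0 < e / 2 by lra.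
have [D aD'] := aD _ e20; have [N aN] := affine_div_le (r + e / 2) D _ e20.
exists N.+1 => //= k Nk.
have := aN k _ (ltnW Nk) (aD' k); rewrite ler_norml.
have : r <= a k / k%:R by rewrite ler_pdivlMr // ltr0n (leq_ltn_trans _ Nk).
lra.
Qed.

Lemma limn_esup_rate_le a r D : (forall k, a k <= r * k%:R + D) ->
  (limn_esup (fun k => (a k / k%:R)%:E) <= r%:E)%E.
Proof.
move=> aD; apply/lee_addgt0Pr => e e0.
have [N aN] := affine_div_le r D _ e0.
apply: (@le_trans _ _ (ereal_sup
  [set (a k / k%:R)%:E | k in [set k | (N <= k)%N]])).
  by apply: ereal_inf_lbound; exists [set k | (N <= k)%N] => //; exists N.
by apply: ge_ereal_sup => _ [k /= Nk <-]; rewrite -EFinD lee_fin aN.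
Qed.

Lemma limn_esup_rate_ge a r : (forall k, r * k%:R <= a k) ->
  (r%:E <= limn_esup (fun k => (a k / k%:R)%:E))%E.
Proof.
move=> ra; apply: le_ereal_inf_tmp => _ [V [N _ NV] <-].
(* The index [N.+1] lies in the tail and is positive; at index [0] the quotient is [0] by
   convention. *)
apply: (@le_trans _ _ (a N.+1 / N.+1%:R)%:E).
  by rewrite lee_fin ler_pdivlMr.
by apply: ereal_sup_ubound; exists N.+1 => //; apply: NV => /=.
Qed.

End Rates.

(** * Plays, and simulations restarted from the initial state *)

Section Play.
Context {A B X : Type} (T : A -> B -> X -> X) (x0 : X).
Implicit Types (sigma : min_strategy A B X) (tau : max_strategy A B X).

Lemma play1 sigma tau k : (play T x0 sigma tau k).1 = x0.
Proof. by elim: k => //= k ->. Qed.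

Lemma size_play sigma tau k : size (play T x0 sigma tau k).2 = k.
Proof. by elim: k => //= k IH; rewrite size_rcons IH. Qed.

Lemma state_rcons (x : X) s (a : A) (b : B) y : state (x, rcons s (a, b, y)) = y.
Proof. by rewrite /state /= map_rcons last_rcons. Qed.

Lemma size_replay x s : size (replay T x s) = size s.
Proof. by elim: s x => //= -[[a b] y] s IH x /=; rewrite IH. Qed.

Lemma replay_rcons x s a b y : replay T x (rcons s (a, b, y)) =
  rcons (replay T x s) (a, b, T a b (state (x, replay T x s))).
Proof. by elim: s x => //= -[[a' b'] y'] s IH x /=; rewrite IH. Qed.

(** For [q > 0] and [n] the largest multiple of [q] up to the number of turns played, this is
    [restart]. *)
Definition simulated n (h : history A B X) : history A B X :=
  (h.1, replay T h.1 (drop n h.2)).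

(** Block [j] starts once [beta j] turns are played, and [idx] recovers the block from the number of
    turns. *)
Definition block_strategy (beta idx : nat -> nat)
    (strat : nat -> min_strategy A B X) : min_strategy A B X :=
  fun h => let j := idx (size h.2) in strat j (simulated (beta j) h).

(** Real and simulated states undergo the same actions, so nonexpansiveness applies to their
    distance. *)
Lemma simulated_play sigma tau n k : (n <= k)%N ->
  let h := play T x0 sigma tau k in
  let a := sigma h in
  state (simulated n (play T x0 sigma tau k.+1)) =
    T a (tau h a) (state (simulated n h)).
Proof.
move=> nk /=; rewrite /simulated /= -cats1 drop_cat size_play.
move: nk; rewrite leq_eqVlt => /orP[/eqP ->|->].
  rewrite ltnn subnn drop0 /= drop_oversize ?size_play //.
by rewrite cats1 replay_rcons state_rcons.
Qed.

Lemma simulated_id sigma tau k :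
  state (simulated k (play T x0 sigma tau k)) = x0.
Proof. by rewrite /simulated drop_oversize ?size_play // /state /= play1. Qed.

End Play.

(** * Payoff of block strategies built from near-optimal actions *)

Section Blocks.
Context {R : realType} {A B X : Type} {d : X -> X -> R}.
Hypothesis hd : hemi_metric d.
Variables (T : A -> B -> X -> X) (x0 : X).
Hypothesis hT : forall a b, nonexpansive d (T a b).
Local Notation S := (shapley T).
Local Notation u_ := (fun k => iter k S (fun x => d x x0)).
Local Notation s_ := (fun k => u_ k x0).

Variable act : nat -> nat -> X -> A.
Hypothesis hact : forall q n x b,
  u_ n (T (act q n x) b x) <= u_ n.+1 x + q.+1%:R^-1.
Variable C : R.
Hypothesis hC : forall a b, d (T a b x0) x0 <= C.

(** After the current turn [q - (size h.2).+1] turns remain. The slack [1 / (q + 1)] per turn adds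
    up to less than [1] over [q] turns. *)
Definition greedy_min q : min_strategy A B X :=
  fun h => act q (q - (size h.2).+1) (state h).

Variables beta len idx : nat -> nat.
Hypothesis beta0 : beta 0%N = 0%N.
Hypothesis betaS : forall j, beta j.+1 = (beta j + len j)%N.
Hypothesis idxP : forall j k, (beta j <= k < beta j.+1)%N -> idx k = j.

Definition block_greedy : min_strategy A B X :=
  block_strategy T beta idx (fun j => greedy_min (len j)).

Variable tau : max_strategy A B X.
Local Notation play_ := (play T x0 block_greedy tau).
Local Notation sim j k := (simulated T (beta j) (play_ k)).

(** The first bound is nonexpansiveness; the second serves for an unfinished block; the third, at
    [l = len j], for a complete one. *)
Lemma block_invariant j l : (l <= len j)%N -> let k := (beta j + l)%N in
  [/\ d (state (play_ k)) (state (sim j k)) <= d (state (play_ (beta j))) x0,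
      d (state (sim j k)) x0 <= C * l%:R &
      u_ (len j - l)%N (state (sim j k)) <= s_ (len j) + l%:R / (len j).+1%:R].
Proof.
elim: l => [|l IH] ll /=.
  by rewrite addn0 simulated_id subn0 mulr0 mul0r addr0 (hemi_metric_xx hd).
have [IH1 IH2 IH3] := IH (ltnW ll).
rewrite addnS simulated_play ?leq_addr // /play iterS -/(play _ _ _ _ _).
set k := (beta j + l)%N in IH1 IH2 IH3 *; set h := play_ k in IH1 IH2 IH3 *.
rewrite /step state_rcons; set a := block_greedy h; set b := tau h a.
split.
- exact: le_trans (hT _ _ _ _) IH1.
- have := hemi_metric_triangle hd (T a b x0) (T a b (state (simulated T (beta j) h))) x0.
  by have := hT a b (state (simulated T (beta j) h)) x0; have := hC a b;
     rewrite -natr1; lra.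
have aE : a = act (len j) (len j - l.+1) (state (simulated T (beta j) h)).
  rewrite /a /block_greedy /block_strategy size_play (idxP j k); last first.
    by rewrite betaS /k; lia.
  rewrite /greedy_min /simulated size_replay size_drop size_play.
  by rewrite /k addKn.
have := hact (len j) (len j - l.+1) (state (simulated T (beta j) h)) b.
rewrite -aE subnSK // => /le_trans -> //.
by rewrite -[l.+1%:R]natr1 mulrDl mul1r addrA lerD2r.
Qed.

(** By the triangle inequality through the simulated state, block [j] adds at most [s_ (len j) + 1],
    where [1] covers the accumulated slack. *)
Lemma block_end j :
  d (state (play_ (beta j))) x0 <= \sum_(i < j) (s_ (len i) + 1).
Proof.
elim: j => [|j IH]; first by rewrite beta0 big_ord0 /= (hemi_metric_xx hd).
have [h1 _] := block_invariant j _ (leqnn _).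
rewrite subnn /= => h3; rewrite betaS big_ord_recr /=.
have := hemi_metric_triangle hd (state (sim j (beta j + len j)))
  (state (play_ (beta j + len j))) x0.
have : (len j)%:R / (len j).+1%:R <= 1 :> R.
  by rewrite ler_pdivrMr // mul1r ler_nat.
by move: (_ / _) h3 => r; lra.
Qed.

Lemma block_payoff j l : (l <= len j)%N ->
  payoff d T x0 block_greedy tau (beta j + l) <=
    \sum_(i < j) (s_ (len i) + 1) + C * l%:R.
Proof.
move=> ll; have [h1 h2 _] := block_invariant j _ ll; rewrite /payoff.
have := hemi_metric_triangle hd (state (sim j (beta j + l)))
  (state (play_ (beta j + l))) x0.
by have := block_end j; lra.
Qed.

End Blocks.

(** The index of [k] is the least [j] with [k < beta j.+1]. *)
Lemma exists_block_index (beta : nat -> nat) :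
  beta 0%N = 0%N -> (forall j, (beta j < beta j.+1)%N) ->
  exists idx : nat -> nat, (forall k, (beta (idx k) <= k < beta (idx k).+1)%N) /\
    forall j k, (beta j <= k < beta j.+1)%N -> idx k = j.
Proof.
move=> beta0 betaS.
have kbeta k : exists j, (k < beta j.+1)%N.
  by exists k; elim: k => [|k IH]; [have := betaS 0%N|have := betaS k.+1]; lia.
have betaW : {homo beta : i j / (i <= j)%N}.
  by apply: homo_leq => [//|j i k /leq_trans|i]; [exact|exact: ltnW].
exists (fun k => ex_minn (kbeta k)); split=> [k|j k /andP[jk kj]].
  case: ex_minnP => -[|j] -> jmin; first by rewrite beta0.
  by rewrite andbT leqNgt; apply/negP => /jmin; rewrite ltnn.
case: ex_minnP => m km mmin; apply/eqP; rewrite eqn_leq mmin //= leqNgt.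
by apply/negP => /betaW; lia.
Qed.

(** * Optimal and cyclic strategies of Min *)

Section MinStrategies.
Context {R : realType} {A B X : Type} {d : X -> X -> R}.
Hypothesis hd : hemi_metric d.
Variables (T : A -> B -> X -> X) (x0 : X).
Hypothesis hT : forall a b, nonexpansive d (T a b).
Local Notation u_ := (fun k => iter k (shapley T) (fun x => d x x0)).
Local Notation s_ := (fun k => u_ k x0).
Variable act : nat -> nat -> X -> A.
Hypothesis hact : forall q n x b,
  u_ n (T (act q n x) b x) <= u_ n.+1 x + q.+1%:R^-1.
Variable C : R.
Hypothesis hC : forall a b, d (T a b x0) x0 <= C.
Variable rho : R.
Hypothesis hrho :
  forall e, 0 < e -> exists D, forall k, s_ k <= (rho + e) * k%:R + D.

(* The [j]-th block has length [j + 1]: long blocks bring the average close to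
   [rho], while the current block and the errors of the [O(sqrt k)] completed
   ones stay sublinear in [k]. *)
Lemma min_rate_strategy : exists sigma : min_strategy A B X,
  forall e, 0 < e -> exists D, forall tau k,
    payoff d T x0 sigma tau k <= (rho + e) * k%:R + D.
Proof.
(* The triangular number [j (j + 1) / 2] is the total length of the first [j] blocks. *)
pose beta j := 'C(j.+1, 2).
have beta0 : beta 0%N = 0%N by [].
have betaS j : beta j.+1 = (beta j + j.+1)%N by rewrite /beta binS bin1.
have [|idx [idxb idxP]] := exists_block_index _ beta0.
  by move=> j; rewrite betaS; lia.
exists (block_greedy T act beta succn idx) => e e0.
have e20 : 0 < e / 2 by lra.
have [D hD] := hrho _ e20.
(* [M * j] collects the errors: [D + 1] for each complete block, [C] and [r] for each turn of the
   unfinished one. *)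
pose r := rho + e / 2; pose M := `|D + 1| + `|r| + `|C|.
exists (M + M ^+ 2 / e) => tau k.
set j := idx k; have /andP[jk kj] := idxb k; rewrite -/j in jk kj.
have [l kE] : exists l, k = (beta j + l)%N by exists (k - beta j)%N; lia.
have lj : (l <= j)%N by move: kj; rewrite betaS kE; lia.
have := block_payoff hd T x0 hT act hact C hC _ _ _ beta0 betaS idxP tau j l
  (leqW lj).
rewrite -kE.
have sumD : \sum_(i < j) (s_ i.+1 + 1) <= r * (beta j)%:R + (D + 1) * j%:R.
  elim: {k jk kj kE lj} j => [|i IH]; first by rewrite big_ord0 beta0 !mulr0 addr0.
  rewrite big_ord_recr /= betaS natrD -[in (D + 1) * _]natr1 !mulrDr mulr1.
  by have := hD i.+1; rewrite /= -/r; move: IH; lra.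
have betaE : (2 * beta j = j * j.+1)%N.
  by elim: (j) => // i IH; rewrite betaS; lia.
have jk2 : j%:R * j%:R <= 2 * k%:R :> R by rewrite -!natrM ler_nat; lia.
have := ler_normM_nat (D + 1) _ _ (leqnn j).
have := ler_normM_nat C _ _ lj.
have := ler_normM_nat (- r) _ _ lj.
rewrite normrN.
(* Young's inequality; the quadratic term is absorbed by [e / 2 * k], because [j ^ 2 <= 2 k]. *)
have Mj : M * j%:R <= e / 4 * (j%:R * j%:R) + M ^+ 2 / e.
  have eM : e * (M ^+ 2 / e) = M ^+ 2 by rewrite mulrC divfK // gt_eqF.
  rewrite -(ler_pM2l e0) mulrDr eM.
  by have := sqr_ge0 (e * j%:R / 2 - M); lra.
have M0 : 0 <= M by rewrite !addr_ge0.
have rk : r * k%:R = r * (beta j)%:R + r * l%:R by rewrite kE natrD mulrDr.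
have ek : e / 2 * k%:R >= e / 4 * (j%:R * j%:R).
  by have := ler_wpM2l (ltW e20) jk2; lra.
have -> : rho + e = r + e / 2 by rewrite /r; lra.
have : M * j%:R = `|D + 1| * j%:R + `|r| * j%:R + `|C| * j%:R.
  by rewrite !mulrDl.
move: sumD Mj rk ek; rewrite mulrDl; set Z := (M ^+ 2 / e); lra.
Qed.

Lemma min_cyclic_strategy e : 0 < e -> exists q (sigma : min_strategy A B X),
  [/\ (1 <= q)%N, cyclic_strategy T q sigma & exists D, forall tau k,
    payoff d T x0 sigma tau k <= (rho + e) * k%:R + D].
Proof.
move=> e0; have e20 : 0 < e / 2 by lra.
have [D hD] := hrho _ e20.
(* For this [q] one has [D + 1 < e / 2 * q], so a block costs at most [(rho + e) * q]. *)
pose q := (Num.truncn ((D + 1) / (e / 2))).+1.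
pose beta j := (j * q)%N; pose idx k := (k %/ q)%N.
exists q, (block_greedy T act beta (fun=> q) idx); split=> //.
  by exists (greedy_min act q).
have sq : s_ q + 1 <= (rho + e) * q%:R.
  have := hD q; have := truncnS_gt ((D + 1) / (e / 2)).
  by rewrite -/q ltr_pdivrMr //; lra.
exists ((`|C| + `|rho + e|) * q%:R) => tau k.
have betaS j : beta j.+1 = (beta j + q)%N by rewrite /beta mulSn addnC.
have idxP j m : (beta j <= m < beta j.+1)%N -> idx m = j.
  move=> /andP[jm mj]; apply/eqP; rewrite eqn_leq /idx leq_divRL //.
  by rewrite -ltnS ltn_divLR // mj.
have kq : (k %% q <= q)%N by rewrite ltnW // ltn_pmod.
have := block_payoff hd T x0 hT act hact C hC beta _ _ (mul0n q) betaS idxP tau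
  (k %/ q)%N _ kq.
rewrite /beta -divn_eq sumr_const card_ord -mulr_natr.
have := ler_normM_nat C _ _ kq; have := ler_normM_nat (- (rho + e)) _ _ kq.
rewrite normrN.
have kE : k%:R = (k %/ q)%:R * q%:R + (k %% q)%:R :> R.
  by rewrite -natrM -natrD -divn_eq.
have := ler_wpM2r (ler0n R (k %/ q)) sq.
rewrite kE; move: (rho + e) => r; lra.
Qed.

End MinStrategies.

(** * Greedy strategies of Max *)

Section MaxStrategies.
Context {R : realType} {A B X : Type} {d : X -> X -> R}.
Variables (T : A -> B -> X -> X) (x0 : X) (rho : R) (v : X -> R).
Hypothesis vL : Lip1 d v.
Hypothesis v_sub : forall x a b,
  (forall b', v (T a b' x) <= v (T a b x)) -> rho + v x <= v (T a b x).

(** Along a greedy play [v x_k - rho k] never decreases. *)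
Lemma greedy_payoff tau : greedy T v tau ->
  forall sigma k, rho * k%:R <= payoff d T x0 sigma tau k.
Proof.
move=> tauG sigma k; rewrite /payoff; set h := play T x0 sigma tau.
suff : rho * k%:R + v x0 <= v (state (h k)) by have := vL (state (h k)) x0; lra.
elim: k => [|k IH]; first by rewrite mulr0 add0r.
rewrite /h /play iterS -/(play _ _ _ _ _) -/h /step state_rcons.
set b := tau (h k) _; have := v_sub _ _ b (tauG (h k) _).
by rewrite -natr1; move: IH; lra.
Qed.

End MaxStrategies.

(** * Uniform value and optimal strategies, from the bounds for both players *)

Theorem theorem18 (R : realType) (X : metricType R) (d : X -> X -> R)
  (hd : hemi_metric d)
  (* the metric, hence the topology, of X is that of d° *)
  (hX : forall x y : X, mdist x y = Num.max (d x y) (d y x))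
  (A B : topologicalType)
  (hA0 : [set: A] !=set0) (hA : compact [set: A])
  (hB0 : [set: B] !=set0) (hB : compact [set: B])
  (T : A -> B -> X -> X)
  (hT : forall a b, nonexpansive d (T a b))
  (hTb : forall (x : X) (a : A), continuous (fun b : B => T a b x))
  (hTa : forall (x : X) (b : B), continuous (fun a : A => T a b x))
  (hTK : forall K : set X, compact K ->
     compact [set y | exists (a : A) (b : B) (x : X), K x /\ y = T a b x])
  (x0 : X) :
  exists rho : R,
    [/\ (fun k : nat =>
           iter k (shapley T) (fun x => d x x0) x0 / k%:R) @ \oo --> rho,
        uniform_value d T x0 rho,
        (forall v : X -> R, Lip1 d v ->
           (forall x, rho + v x <= shapley T v x) ->
           (exists tau : max_strategy A B X, stationary tau /\ greedy T v tau) /\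
           (forall tau : max_strategy A B X, stationary tau -> greedy T v tau ->
              optimal_max d T x0 rho tau)),
        (exists sigma : min_strategy A B X, optimal_min d T x0 rho sigma) &
        (forall eps : R, 0 < eps ->
           exists (q : nat) (sigma : min_strategy A B X),
             [/\ (1 <= q)%N, cyclic_strategy T q sigma &
                 eps_optimal_min d T x0 rho eps sigma])].
Proof.
have hO x : compact [set y | exists a b, y = T a b x].
  rewrite (_ : [set y | _] = [set y | exists (a : A) (b : B) (z : X),
    [set x] z /\ y = T a b z]); first by apply: hTK; exact: compact_set1.
  apply/seteqP; split=> [y [a [b ->]]|y [a [b [_ [-> ->]]]]]; exists a, b => //.
  by exists x.
have [C0 s_ge] := iter_shapley_bounded_below hd hX hA0 hB0 T hT hO x0.
have [rho [rho_le hrho]] := subadditive_rate _ _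
  (iter_shapley_subadditive hd hX hA0 hB0 T hT hO x0) s_ge.
have [act hact] : exists act : nat -> nat -> X -> A, forall q n x b,
    iter n (shapley T) (d ^~ x0) (T (act q n x) b x) <=
    iter n.+1 (shapley T) (d ^~ x0) x + q.+1%:R^-1.
  have h (p : nat * nat * X) : exists a, forall b,
      iter p.1.2 (shapley T) (d ^~ x0) (T a b p.2) <=
      iter p.1.2.+1 (shapley T) (d ^~ x0) p.2 + p.1.1.+1%:R^-1.
    apply: (shapley_adherent hX hA0 hB0 T hO) => //.
    exact: iter_shapley_Lip1.
  have [f hf] := choice h.
  by exists (fun q n x => f (q, n, x)) => q n x b; exact: hf (q, n, x) b.
have [C hC'] := Lip1_orbit_bounded hX T hO _ x0 (Lip1_to hd x0).
have hC a b : d (T a b x0) x0 <= C by apply: le_trans (ler_norm _) (hC' a b).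
have greedy_rate v : Lip1 d v -> (forall x, rho + v x <= shapley T v x) ->
    forall tau, greedy T v tau -> forall sigma k,
    rho * k%:R <= payoff d T x0 sigma tau k.
  move=> vL v_sub; apply: greedy_payoff => // x a b bmax.
  exact: le_trans (v_sub x) (shapley_le hX hB0 T hO _ _ _ _ vL bmax).
have greedy_exists v : Lip1 d v ->
    exists tau : max_strategy A B X, stationary tau /\ greedy T v tau.
  move=> vL.
  have h (p : X * A) : exists b, forall b', v (T p.2 b' p.1) <= v (T p.2 b p.1).
    have [|b _ bmax] := @compact_EVT_max _ R (fun b => v (T p.2 b p.1)) _ hB0 hB.
      apply: continuous_subspaceT => b; apply: continuous_comp; first exact: hTb.
      exact: (Lip1_continuous hX _ vL).
    by exists b => b'; apply: bmax; rewrite inE.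
  have [g hg] := choice h.
  exists (fun h a => g (state h, a)); split; first by exists (fun x a => g (x, a)).
  by move=> z a b; exact: hg (state z, a) b.
have [sigma sigmaP] := min_rate_strategy hd T x0 hT act hact C hC rho hrho.
have [v [vL v_sub]] := exists_subsolution hd hX hA0 hB0 T hT hO x0 rho rho_le.
have [tau [tau_st tauG]] := greedy_exists v vL.
exists rho; split.
- exact: cvg_rate.
(* The same two strategies serve for every [e]; only the threshold depends on it. *)
- move=> e e0; have e20 : 0 < e / 2 by lra.
  have [D hD] := sigmaP _ e20; have [N hN] := affine_div_le (rho + e / 2) D _ e20.
  exists sigma, tau, N.+1 => k Nk sigma' tau'; split.
    by have := hN k _ (ltnW Nk) (hD tau' k); lra.
  have : rho <= payoff d T x0 sigma' tau k / k%:R.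
    rewrite ler_pdivlMr ?ltr0n; last by lia.
    exact: greedy_rate v_sub _ tauG _ _.
  lra.
- move=> v' v'L v'_sub; split; first exact: greedy_exists.
  move=> tau' _ tau'G sigma'; rewrite subr0; apply: limn_esup_rate_ge.
  exact: greedy_rate v'_sub _ tau'G _.
- exists sigma => tau'; rewrite addr0; apply/lee_addgt0Pr => e e0.
  have [D hD] := sigmaP e e0.
  by rewrite -EFinD; apply: limn_esup_rate_le (hD tau').
- move=> e e0.
  have [q [sigma' [q1 sigma'_cyc [D hD]]]] :=
    min_cyclic_strategy hd T x0 hT act hact C hC rho hrho e e0.
  by exists q, sigma'; split=> // tau'; apply: limn_esup_rate_le (hD tau').
Qed.
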